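(* Let $0<\underline{x}_1\le\overline{x}_1<1$ and $\rho\in(\overline{x}_1\varepsilon,\varepsilon)$. Let the data-generating distribution $\mathbb{P}_0$ of $(\tilde\xi_1,\tilde\xi_2)$ be the two-point distribution with $\mathbb{P}_0[(\tilde\xi_1,\tilde\xi_2)=(1,0)]=\rho$ and $\mathbb{P}_0[(\tilde\xi_1,\tilde\xi_2)=(0,0)]=1-\rho$. Consider the distributionally robust chance constrained program $$(\star)\qquad\min_{\boldsymbol{x}\in\mathbb{R}^2}\; x_1\quad\text{s.t.}\quad \mathbb{P}[x_1>\tilde\xi_1,\;x_2>\tilde\xi_2]\ge 1-\varepsilon\;\;\forall\mathbb{P}\in\mathcal{F}(\theta),\quad \underline{x}_1\le x_1\le\overline{x}_1,\;x_2\ge 0.$$ Then, as $N\to\infty$, with probability going to $1$: (i) the Bonferroni approximation of $(\star)$, which replaces the joint chance constraint with $$\mathbb{P}[x_1>\tilde\xi_1]\ge 1-\varepsilon_1\;\forall\mathbb{P}\in\mathcal{F}(\theta),\qquad \mathbb{P}[x_2>\tilde\xi_2]\ge 1-\varepsilon_2\;\forall\mathbb{P}\in\mathcal{F}(\theta),$$ becomes exact if the risk thresholds $(\varepsilon_1,\varepsilon_2)$ are sufficiently close to $(\varepsilon,0)$; that is, there is $\bar\varepsilon<\varepsilon$ such that for every fixed $\varepsilon_1\in(\bar\varepsilon,\varepsilon)$ and $\varepsilon_2=\varepsilon-\varepsilon_1$, the probability that the approximation has the same optimal value as $(\star)$ tends to $1$; (ii) the worst-case CVaR approximation of $(\star)$,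 which replaces the joint chance constraint with $$\sup_{\mathbb{P}\in\mathcal{F}(\theta)}\mathbb{P}\text{-CVaR}_\varepsilon\big(\max\{w_1(\tilde\xi_1-x_1),\,w_2(\tilde\xi_2-x_2)\}\big)\le 0,$$ becomes infeasible for any choice of scaling factors $(w_1,w_2)\in\Delta^2_{++}$.
   Context: Risk threshold $\varepsilon\in(0,1)$. The samples $\hat{\boldsymbol{\xi}}_1,\dots,\hat{\boldsymbol{\xi}}_N\in\mathbb{R}^2$ are drawn independently from $\mathbb{P}_0$; ''with probability going to $1$'' refers to the sampling. $\hat{\mathbb{P}}=\frac1N\sum_{i=1}^N\delta_{\hat{\boldsymbol{\xi}}_i}$ is the empirical distribution and $\mathcal{F}(\theta)=\{\mathbb{P}\in\mathcal{P}(\mathbb{R}^2) : d_{\rm W}(\mathbb{P},\hat{\mathbb{P}})\le\theta\}$, where $\mathcal{P}(\mathbb{R}^2)$ is the set of probability distributions on $\mathbb{R}^2$ and $d_{\rm W}(\mathbb{P}_1,\mathbb{P}_2)$ is the type-1 Wasserstein distance (infimum of $\mathbb{E}[\|\tilde{\boldsymbol{\xi}}-\tilde{\boldsymbol{\xi}}'\|]$ over all joint distributions with marginals $\mathbb{P}_1,\mathbb{P}_2$) for a $p$-norm $\|\cdot\|$ with $p\in\mathbb{Q}$, $p>1$. The radius $\theta=\theta_N>0$ satisfies $\theta_N\to0$ as $N\to\infty$, and the probability that $\mathbb{P}_0\in\mathcal{F}(\theta_N)$ tends to one as $N\to\infty$. $\mathbb{P}\text{-CVaR}_\varepsilon(\ell(\tilde{\boldsymbol{\xi}}))=\inf\{\tau+\mathbb{E}_{\mathbb{P}}[(\ell(\tilde{\boldsymbol{\xi}})-\tau)^+]/\varepsilon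 : \tau\in\mathbb{R}\}$ with $(y)^+=\max\{y,0\}$, and $\Delta^2_{++}=\{\boldsymbol{w}\in(0,1)^2 : w_1+w_2=1\}$. Bonferroni risk thresholds are numbers $\varepsilon_1,\varepsilon_2\ge0$ with $\varepsilon_1+\varepsilon_2=\varepsilon$. An approximation is exact if its optimal value equals that of the original problem, and infeasible if no $\boldsymbol{x}$ satisfies all its constraints. *)

(* Defs.v *)
From mathcomp Require Import all_boot all_order all_algebra finmap.
From mathcomp Require Import all_classical all_reals all_analysis.

Set Implicit Arguments.
Unset Strict Implicit.
Unset Printing Implicit Defensive.

Import Order.TTheory GRing.Theory Num.Theory numFieldNormedType.Exports.

Local Open Scope classical_set_scope.
Local Open Scope ring_scope.

Section sampling.
Context {d : measure_display} {Omega : measurableType d} {R : realType}.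
Variable Pr : probability Omega R.

Definition mutually_independent {d' : measure_display} {T : measurableType d'}
    (X : nat -> Omega -> T) : Prop :=
  forall (J : {fset nat}) (A : nat -> set T), (forall j, measurable (A j)) ->
    Pr (\bigcap_(j in [set` J]) X j @^-1` A j) =
    (\prod_(j <- J) Pr (X j @^-1` A j))%E.

(* [Pr] is only meaningful on measurable sets, so "the probability of [A N]
   tends to 1" is stated through measurable subevents (inner probability).
   If every [A N] is measurable this is just [Pr (A N) --> 1]. *)
Definition with_prob_to_1 (A : nat -> set Omega) : Prop :=
  exists E : nat -> set Omega,
    [/\ forall N, measurable (E N),
        forall N, E N `<=` A N &
        Pr (E N) @[N --> \oo] --> 1%E].

(* For [N = 0] this is the zero measure, as [0^-1 = 0]. *)
Definition empirical {d' : measure_display} {T : measurableType d'}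
    (X : nat -> Omega -> T) (N : nat) (omega : Omega) :
    {measure set T -> \bar R} :=
  mscale (N%:R^-1)%:nng (msum (fun i => \d_(X i omega)) N).

End sampling.

Section program.
Context {R : realType}.

Definition pnorm (p : R) (v : R * R) : R :=
  (`|v.1| `^ p + `|v.2| `^ p) `^ p^-1.

Definition coupling (mu nu : {measure set (R * R) -> \bar R}) :
    set (probability ((R * R) * (R * R))%type R) :=
  [set pi | (forall A, measurable A -> pi (fst @^-1` A) = mu A) /\
            (forall A, measurable A -> pi (snd @^-1` A) = nu A)].

Definition wasserstein (p : R) (mu nu : {measure set (R * R) -> \bar R}) :
    \bar R :=
  ereal_inf [set (\int[pi]_z (pnorm p (z.1 - z.2))%:E)%E | pi in coupling mu nu].

Definition wasserstein_ball (p : R) (mu : {measure set (R * R) -> \bar R})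
    (theta : R) : set (probability (R * R)%type R) :=
  [set P | (wasserstein p P mu <= theta%:E)%E].

Definition CVaR (eps : R) (P : probability (R * R)%type R)
    (loss : R * R -> R) : \bar R :=
  ereal_inf [set (tau%:E +
    eps^-1%:E * \int[P]_xi (Num.max (loss xi - tau) 0)%:E)%E | tau in [set: R]].

Definition base_constraints (xlo xhi : R) : set (R * R) :=
  [set x | xlo <= x.1 <= xhi /\ 0 <= x.2].

Definition joint_feasible (xlo xhi eps : R)
    (F : set (probability (R * R)%type R)) : set (R * R) :=
  base_constraints xlo xhi `&`
  [set x | forall P, F P ->
    ((1 - eps)%:E <= P [set xi | (xi.1 < x.1)%R /\ (xi.2 < x.2)%R])%E].

Definition bonferroni_feasible (xlo xhi eps1 eps2 : R)
    (F : set (probability (R * R)%type R)) : set (R * R) :=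
  base_constraints xlo xhi `&`
  [set x |
    (forall P, F P -> ((1 - eps1)%:E <= P [set xi | (xi.1 < x.1)%R])%E) /\
    (forall P, F P -> ((1 - eps2)%:E <= P [set xi | (xi.2 < x.2)%R])%E)].

Definition cvar_feasible (xlo xhi eps : R) (w : R * R)
    (F : set (probability (R * R)%type R)) : set (R * R) :=
  base_constraints xlo xhi `&`
  [set x | (ereal_sup [set CVaR eps P (fun xi =>
      Num.max (w.1 * (xi.1 - x.1))%R (w.2 * (xi.2 - x.2))%R) | P in F] <= 0)%E].

(* The optimal value of [min x.1] over a feasible set; [+oo] if infeasible. *)
Definition optimal_value (feasible : set (R * R)) : \bar R :=
  ereal_inf [set x.1%:E | x in feasible].

Definition open_simplex : set (R * R) :=
  [set w | [/\ 0 < w.1 < 1, 0 < w.2 < 1 & w.1 + w.2 = 1]].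

End program.

(* Main.v *)
Require Import Defs.
From mathcomp Require Import all_boot all_order all_algebra.
From mathcomp Require Import all_classical all_reals all_analysis.
From mathcomp Require Import measurable_realfun ring lra.

Import Order.TTheory GRing.Theory Num.Theory numFieldNormedType.Exports.

(** On the event that [P0] lies in the ball, which has probability tending
    to 1, both claims are deterministic as soon as the radius is small.

    Exactness of Bonferroni.  Any [P] in the ball and [P0] are both
    [theta]-close to the same empirical distribution.  Markov's inequality on a
    nearly optimal coupling shows that moving a distribution by [theta] carries
    mass at most [2 * theta / b] across a strip of width [b] of a 1-Lipschitz
    function.  Going from [P] to the empirical distribution and on to [P0]
    therefore bounds every tail of [P] by a tail of [P0] up to
    [O(theta)] ([wasserstein_ball_tail]).  Under [P0] the first coordinate is
    positive with probability at most [rho] and the second with probability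
    zero.  Hence, for [rho < eps1 < eps], the
    point [(xlo, 1)] satisfies both Bonferroni constraints once [theta] is
    small ([two_point_bonferroni]).  By the union bound it is then feasible in
    the joint program as well, and as [xlo] is a lower bound of the objective,
    both optimal values are [xlo].

    Infeasibility of CVaR.  Already under [P0] the CVaR of the scaled loss at a
    decision [x] is at least [w1 * (rho - eps * x1) / eps], which is positive
    because [x1 <= xhi] and [xhi * eps < rho] ([two_point_cvar]).  Scaling the
    loss cannot repair this: the excess [1 - x1] on the atom [(1, 0)]
    is weighted by the same [w1] as the slack [x1] on the atom [(0, 0)]. *)

Local Open Scope classical_set_scope.
Local Open Scope ring_scope.

(** * Events of probability tending to one *)

Lemma with_prob_to_1_near_sub (R : realType) (d : measure_display)
    (Omega : measurableType d) (Pr : probability Omega R)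
    (A B : nat -> set Omega) :
  with_prob_to_1 Pr A -> (\forall N \near \oo, A N `<=` B N) ->
  with_prob_to_1 Pr B.
Proof.
move=> [E [mE EA PE1]] AB.
(* The finitely many early events, where the inclusion may fail, are made
   empty, which does not affect the limit. *)
exists (fun N => if `[< A N `<=` B N >] then E N else set0); split.
- by move=> N; case: ifP.
- move=> N; case: asboolP => [sAB|_]; last exact: sub0set.
  exact: subset_trans (EA N) sAB.
- apply: cvg_trans PE1; apply: near_eq_cvg.
  by apply: filterS AB => N sAB; case: asboolP.
Qed.

(** * Tails under Wasserstein perturbations *)

Lemma pnorm_ge_coordinates (R : realType) (p : R) (v : R * R) :
  0 < p -> `|v.1| <= pnorm p v /\ `|v.2| <= pnorm p v.
Proof.
move=> p0.
have root (a : R) : 0 <= a -> a = (a `^ p) `^ p^-1.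
  by move=> a0; rewrite -powRrM divff ?gt_eqF// powRr1.
split; rewrite {1}(root _ (normr_ge0 _)); apply: ge0_ler_powR;
  rewrite ?nnegrE ?invr_ge0 ?(ltW p0) ?addr_ge0 ?powR_ge0//.
- by rewrite lerDl powR_ge0.
- by rewrite lerDr powR_ge0.
Qed.

Lemma measurable_transport_cost (R : realType) (p : R) :
  measurable_fun setT (fun z : (R * R) * (R * R) => pnorm p (z.1 - z.2)).
Proof.
have powT (q : R) (f : (R * R) * (R * R) -> R) : measurable_fun setT f ->
    measurable_fun setT (fun z => f z `^ q).
  by move=> mf; apply: (@measurableT_comp _ _ _ _ _ _ (@powR R ^~ q)).
apply: (powT); apply: measurable_funD; apply: (powT);
  apply: measurableT_comp => //;
  apply: measurable_funB; by do 2!(apply: measurableT_comp => //).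
Qed.

Lemma measurable_tail (R : realType) (d : measure_display)
    (T : measurableType d) (f : T -> R) (t : R) :
  measurable_fun setT f -> measurable [set x | t <= f x].
Proof.
move=> mf; rewrite -[X in measurable X]setTI.
by apply: measurable_fun_le.
Qed.

(** If [g] reaches [a + b] while [h] stays below [a], then [k >= b], and
    Markov's inequality bounds the probability of this. *)
Lemma tail_perturbation (R : realType) (d : measure_display)
    (T : measurableType d) (pi : probability T R) (g h k : T -> R) (a b c : R) :
  measurable_fun setT g -> measurable_fun setT h -> measurable_fun setT k ->
  0 < b -> (forall z, 0 <= k z) -> (forall z, g z - h z <= k z) ->
  (\int[pi]_z (k z)%:E <= c%:E)%E ->
  (pi [set z | (a + b <= g z)%R] <= pi [set z | (a <= h z)%R] + (c / b)%:E)%E.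
Proof.
move=> mg mh mk b0 k0 ghk kc.
have mT := measurable_tail R _ T.
have sub : [set z | (a + b <= g z)%R] `<=`
    [set z | (a <= h z)%R] `|` [set z | (b <= k z)%R].
  move=> z /= abg; have := ghk z.
  by case: (lerP a (h z)) => ha gk; [left|right] => //=; lra.
apply: (le_trans (le_measure pi _ _ sub)); rewrite ?inE.
- exact: mT.
- by apply: measurableU; apply: mT.
apply: (le_trans (measureU2 pi (mT _ _ mh) (mT _ _ mk))).
rewrite leeD2l//.
have mE : measurable_fun setT (EFin \o k) by exact/measurable_EFinP.
have := le_integral_abse pi measurableT mE b0.
rewrite setTI.
under eq_integral do rewrite /= ger0_norm//.
move=> /le_trans/(_ kc).
rewrite (_ : [set x | _] = [set z | (b <= k z)%R]); last first.
  by apply/seteqP; split => z /=; rewrite lee_fin ger0_norm.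
by rewrite EFinM muleC lee_pdivlMr.
Qed.

(** The infimum need not be attained a priori; doubling the radius, which is
    harmless for asymptotics, yields an actual coupling. *)
Lemma wasserstein_le_coupling (R : realType) (p : R)
    (mu nu : {measure set (R * R) -> \bar R}) (theta : R) :
  0 < theta -> (wasserstein p mu nu <= theta%:E)%E ->
  exists2 pi, coupling mu nu pi &
    (\int[pi]_z (pnorm p (z.1 - z.2))%:E <= (2 * theta)%R%:E)%E.
Proof.
move=> th0 W.
have /ereal_inf_lt[_ [pi cpi <-] /ltW ?] :
    (wasserstein p mu nu < (2 * theta)%R%:E)%E.
  by apply: le_lt_trans W _; rewrite lte_fin; lra.
by exists pi.
Qed.

(** The threshold drops from [t] to [t / 3] in two steps of width [t / 3]: one
    along a coupling of [P] with the centre, one along a coupling of [Q] with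
    the centre, each of cost at most [2 * theta]. *)
Lemma wasserstein_ball_tail (R : realType) (p : R)
    (Phat : {measure set (R * R) -> \bar R})
    (P Q : probability (R * R)%type R) (f : R * R -> R) (theta t : R) :
  measurable_fun setT f ->
  (forall v w, `|f v - f w| <= pnorm p (v - w)) ->
  0 < theta -> 0 < t ->
  wasserstein_ball p Phat theta P -> wasserstein_ball p Phat theta Q ->
  (P [set v | (t <= f v)%R] <=
   Q [set v | (t / 3 <= f v)%R] + (12 * theta / t)%:E)%E.
Proof.
move=> mf lipf th0 t0.
move=> /(wasserstein_le_coupling _ _ _ _ _ th0)[pi [piP piPhat] piC].
move=> /(wasserstein_le_coupling _ _ _ _ _ th0)[pi' [piQ piQhat] piC'].
have mT u : measurable [set v | (u <= f v)%R] by exact: measurable_tail.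
have t30 : 0 < t / 3 by lra.
have cost0 (z : (R * R) * (R * R)) : 0 <= pnorm p (z.1 - z.2).
  exact: le_trans (normr_ge0 _) (lipf _ _).
have mcost := @measurable_transport_cost R p.
have mf1 : measurable_fun setT (fun z : (R * R) * (R * R) => f z.1).
  exact: measurableT_comp.
have mf2 : measurable_fun setT (fun z : (R * R) * (R * R) => f z.2).
  exact: measurableT_comp.
have fromP : (P [set v | (t <= f v)%R] <=
    Phat [set v | (t / 3 + t / 3 <= f v)%R] + (2 * theta / (t / 3))%:E)%E.
  rewrite -piP// -piPhat//.
  have := @tail_perturbation _ _ _ pi _ _ _ (t / 3 + t / 3) _ _
    mf1 mf2 mcost t30 cost0 _ piC.
  rewrite (_ : t / 3 + t / 3 + t / 3 = t); last by lra.
  by apply=> z; apply: le_trans (ler_norm _) (lipf _ _).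
have toQ : (Phat [set v | (t / 3 + t / 3 <= f v)%R] <=
    Q [set v | (t / 3 <= f v)%R] + (2 * theta / (t / 3))%:E)%E.
  rewrite -piQ// -piQhat//.
  apply: (@tail_perturbation _ _ _ pi' _ _ _ (t / 3) _ _
    mf2 mf1 mcost t30 cost0 _ piC').
  by move=> z; apply: le_trans (ler_norm _) _; rewrite distrC; exact: lipf.
apply: le_trans fromP _; apply: le_trans (leeD2r _ toQ) _.
rewrite -addeA -EFinD leeD2l// lee_fin.
rewrite le_eqVlt; apply/orP; left; apply/eqP; field.
by rewrite gt_eqF.
Qed.

(** * Atoms and the conditional value-at-risk *)

Lemma measurable_plane_point (R : realType) (z : R * R) : measurable [set z].
Proof.
rewrite (_ : [set z] = [set z.1] `*` [set z.2]); first exact: measurableX.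
by apply/seteqP; split => [w ->//|[w1 w2]/= [-> ->]]; case: z.
Qed.

(** The left-hand side averages the loss over a part of mass [eps]
    assembled from the two atoms.  It bounds the objective at each [tau]:
    dropping the positive part on [z1] and on a share [eps - r1] of the mass of
    [z0] leaves an expression in which [tau] cancels. *)
Lemma CVaR_two_atoms (R : realType) (eps r0 r1 : R)
    (P : probability (R * R)%type R) (loss : R * R -> R) (z0 z1 : R * R) :
  measurable_fun setT loss -> z0 != z1 -> P [set z0] = r0%:E ->
  P [set z1] = r1%:E -> 0 < eps -> r1 <= eps <= r0 + r1 ->
  (((r1 * loss z1 + (eps - r1) * loss z0) / eps)%:E <= CVaR eps P loss)%E.
Proof.
move=> ml z01 P0 P1 e0 /andP[r1e er].
have m1 := @measurable_plane_point R.
apply: le_ereal_inf_tmp => _ [tau _ <-].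
set g := fun z => (Num.max (loss z - tau) 0)%:E.
have mg : measurable_fun setT g.
  apply/measurable_EFinP; apply: measurable_maxr => //.
  exact: measurable_funB.
have g0 z : (0 <= g z)%E by rewrite lee_fin le_max lexx orbT.
have at1 (z : R * R) : (\int[P]_(x in [set z]) g x = g z * P [set z])%E.
  rewrite -integral_cst//; apply: eq_integral => x.
  by rewrite inE /= => ->.
have lb : (g z0 * r0%:E + g z1 * r1%:E <= \int[P]_x g x)%E.
  rewrite -P0 -P1 -!at1 -ge0_integral_setU//.
  - apply: ge0_subset_integral => //; exact: measurableU.
  - exact: measurable_funTS.
  - by apply/disj_set2P; rewrite -subset0 => z /= [->] /eqP; apply/negP.
have eV0 : 0 < eps^-1 by rewrite invr_gt0.
apply: le_trans (leeD2l _ (lee_wpmul2l _ lb)); last by rewrite lee_fin ltW.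
rewrite /g /= -?(EFinM, EFinD) lee_fin.
have r10 : 0 <= r1 by rewrite -lee_fin -P1 measure_ge0.
set u0 := Num.max _ _; set u1 := Num.max _ _.
have u00 : 0 <= u0 by rewrite le_max lexx orbT.
have u0l : loss z0 - tau <= u0 by rewrite le_max lexx.
have u1l : loss z1 - tau <= u1 by rewrite le_max lexx.
rewrite ler_pdivrMr// [leRHS]mulrDl (mulrC eps^-1) divfK ?gt_eqF//.
have h1 : r1 * (loss z1 - tau) <= u1 * r1 by rewrite mulrC ler_wpM2r.
have h2 : (eps - r1) * (loss z0 - tau) <= u0 * r0.
  apply: (@le_trans _ _ (u0 * (eps - r1))).
    by rewrite mulrC ler_wpM2r// subr_ge0.
  by rewrite ler_wpM2l//; lra.
lra.
Qed.

(** * Feasible sets and optimal values *)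

Lemma probability_gt_tail (R : realType) (P : probability (R * R)%type R)
    (f : R * R -> R) (t e : R) :
  measurable_fun setT f -> (P [set v | (t <= f v)%R] <= e%:E)%E ->
  ((1 - e)%:E <= P [set v | (f v < t)%R])%E.
Proof.
move=> mf Pe; have mT := measurable_tail R _ _ f t mf.
rewrite (_ : [set v | (f v < t)%R] = ~` [set v | (t <= f v)%R]); last first.
  by apply/seteqP; split => v /=; rewrite ltNge => /negP.
by rewrite probability_setC// EFinB leeB.
Qed.

(** The union bound for the two complementary events. *)
Lemma bonferroni_sub_joint (R : realType) (xlo xhi eps1 eps2 : R)
    (F : set (probability (R * R)%type R)) :
  bonferroni_feasible xlo xhi eps1 eps2 F `<=`
  joint_feasible xlo xhi (eps1 + eps2) F.
Proof.
move=> x [bx [F1 F2]]; split => // P FP.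
have mlt (f : R * R -> R) (t : R) : measurable_fun setT f ->
    measurable [set v | (f v < t)%R].
  move=> mf; rewrite (_ : [set v | _] = ~` [set v | (t <= f v)%R]).
    by apply: measurableC; exact: measurable_tail.
  by apply/seteqP; split => v /=; rewrite ltNge => /negP.
have mA := mlt fst x.1 measurable_fst; have mB := mlt snd x.2 measurable_snd.
set A := [set v | _] in mA; set B := [set v | _] in mB.
have PC (C : set (R * R)) (e : R) : measurable C -> ((1 - e)%:E <= P C)%E ->
    (P (~` C) <= e%:E)%E.
  move=> mC; rewrite probability_setC// -(fineK (fin_num_measure P C mC)).
  by rewrite -EFinB !lee_fin; lra.
rewrite (_ : [set v | _] = A `&` B)// -[A `&` B]setCK setCI.
rewrite probability_setC; last by apply: measurableU; exact: measurableC.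
rewrite EFinB leeB// EFinD.
apply: (le_trans (measureU2 P (measurableC mA) (measurableC mB))).
by apply: leeD; apply: PC => //; [exact: F1|exact: F2].
Qed.

Lemma optimal_value_lower_bound (R : realType) (xlo xhi y : R)
    (S : set (R * R)) :
  S `<=` base_constraints xlo xhi -> S (xlo, y) -> optimal_value S = xlo%:E.
Proof.
move=> Sb Sxlo; apply/eqP; rewrite eq_le; apply/andP; split.
  by apply: ereal_inf_lbound; exists (xlo, y).
by apply: le_ereal_inf_tmp => _ [x /Sb[/andP[? _] _] <-]; rewrite lee_fin.
Qed.

(** * The two-point data-generating distribution *)

Section two_point.
Context (R : realType) (rho : R) (P0 : probability (R * R)%type R)
  (P0_10 : P0 [set (1, 0)] = rho%:E)
  (P0_00 : P0 [set (0, 0)] = (1 - rho)%:E).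

Lemma two_point_tail_fst (t : R) : 0 < t ->
  (P0 [set v | (t <= v.1)%R] <= rho%:E)%E.
Proof.
move=> t0.
have -> : rho%:E = P0 (~` [set (0, 0)]).
  rewrite probability_setC ?P0_00; last exact: measurable_plane_point.
  by rewrite -EFinB; congr EFin; lra.
apply: le_measure; rewrite ?inE.
- exact: (measurable_tail R _ _ fst t measurable_fst).
- by apply: measurableC; exact: measurable_plane_point.
- by move=> v /= tv v0; move: tv; rewrite v0 /= leNgt t0.
Qed.

Lemma two_point_tail_snd (t : R) : 0 < t -> P0 [set v | (t <= v.2)%R] = 0%E.
Proof.
move=> t0; have m1 := @measurable_plane_point R.
have full : P0 ([set (0, 0)] `|` [set (1, 0)]) = 1%E.
  rewrite measureU//; last first.
    rewrite -subset0 => v [/= -> []] /eqP; rewrite eq_sym oner_eq0//.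
  by rewrite [X in (X + _)%E]P0_00 [X in (_ + X)%E]P0_10 -EFinD subrK.
apply/eqP; rewrite eq_le measure_ge0 andbT.
have -> : 0%E = P0 (~` ([set (0, 0)] `|` [set (1, 0)])).
  by rewrite probability_setC ?full ?subee//; exact: measurableU.
apply: le_measure; rewrite ?inE.
- exact: (measurable_tail R _ _ snd t measurable_snd).
- by apply: measurableC; exact: measurableU.
- by move=> v /= tv [] v0; move: tv; rewrite v0 /= leNgt t0.
Qed.

(** The value 1 for the second decision is arbitrary: [P0] has no mass at a
    positive second coordinate, so any fixed positive value works for small
    [theta], however small [eps2 > 0] is. *)
Lemma two_point_bonferroni (p xlo xhi eps1 eps2 theta : R)
    (Phat : {measure set (R * R) -> \bar R}) :
  0 < p -> 0 < theta -> 0 < xlo <= xhi ->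
  12 * theta / xlo <= eps1 - rho -> 12 * theta <= eps2 ->
  wasserstein_ball p Phat theta P0 ->
  bonferroni_feasible xlo xhi eps1 eps2
    (wasserstein_ball p Phat theta) (xlo, 1).
Proof.
move=> p0 th0 /andP[xlo0 xlo_xhi] th1 th2 FP0; split.
  by split; rewrite /= ?lexx ?ler01.
split => P FP; apply: probability_gt_tail => //=.
- have lip1 (v w : R * R) : `|v.1 - w.1| <= pnorm p (v - w).
    exact: (pnorm_ge_coordinates _ _ (v - w) p0).1.
  apply: (le_trans (wasserstein_ball_tail _ _ _ _ _ _ _ _
    measurable_fst lip1 th0 xlo0 FP FP0)).
  have xlo3 : 0 < xlo / 3 by lra.
  apply: (le_trans (leeD2r _ (two_point_tail_fst _ xlo3))).
  by rewrite -EFinD lee_fin; lra.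
- have lip2 (v w : R * R) : `|v.2 - w.2| <= pnorm p (v - w).
    exact: (pnorm_ge_coordinates _ _ (v - w) p0).2.
  apply: (le_trans (wasserstein_ball_tail _ _ _ _ _ _ _ _
    measurable_snd lip2 th0 ltr01 FP FP0)).
  by rewrite two_point_tail_snd ?add0e ?lee_fin ?divr1; lra.
Qed.

(** [P0] itself violates the constraint: its [eps]-tail consists of the atom
    [(1, 0)] of mass [rho], where the loss is at least [w1 * (1 - x1)],
    completed by mass [eps - rho] at [(0, 0)], where it is at least
    [- w1 * x1]. *)
Lemma two_point_cvar (xlo xhi eps : R) (w : R * R)
    (F : set (probability (R * R)%type R)) :
  0 < eps -> xhi * eps < rho <= eps -> eps <= 1 -> 0 < w.1 ->
  F P0 -> cvar_feasible xlo xhi eps w F = set0.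
Proof.
move=> e0 /andP[xrho rhoe] e1 w1 FP0; rewrite -subset0.
move=> x [[/andP[_ xxhi] x20]].
rewrite /=; apply/negP; rewrite -ltNge.
set loss := fun v : R * R => _.
have mloss : measurable_fun setT loss.
  by apply: measurable_maxr; apply: measurable_funM => //;
    apply: measurable_funB.
have z01 : ((0, 0) : R * R) != (1, 0).
  by apply/eqP => -[] /eqP; rewrite eq_sym oner_eq0.
have rhos : rho <= eps <= (1 - rho) + rho by rewrite rhoe subrK.
have := CVaR_two_atoms R eps _ _ P0 loss _ _ mloss z01 P0_00 P0_10 e0 rhos.
move=> CV; apply: lt_le_trans (ereal_sup_ubound _); last by exists P0.
apply: lt_le_trans CV; rewrite lte_fin divr_gt0//.
have l1 : w.1 * (1 - x.1) <= loss (1, 0) by rewrite le_max lexx.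
have l0 : w.1 * (0 - x.1) <= loss (0, 0) by rewrite le_max lexx.
have rho0 : 0 <= rho by rewrite -lee_fin -P0_10 measure_ge0.
have h1 := ler_wpM2l rho0 l1.
have h0 : (eps - rho) * (w.1 * (0 - x.1)) <= (eps - rho) * loss (0, 0).
  by rewrite ler_wpM2l// subr_ge0.
have x1e : x.1 * eps <= xhi * eps by rewrite ler_wpM2r// ltW.
have : 0 < w.1 * (rho - x.1 * eps) by rewrite mulr_gt0//; lra.
lra.
Qed.

End two_point.

Theorem proposition13 (R : realType) (d : measure_display)
    (Omega : measurableType d) (Pr : probability Omega R)
    (p : rat) (eps xlo xhi rho : R)
    (P0 : probability (R * R)%type R)
    (xi : nat -> {RV Pr >-> (R * R)%type}) (theta : nat -> R)
    (p_gt1 : 1 < p)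
    (eps01 : 0 < eps < 1)
    (xlo_gt0 : 0 < xlo) (xlo_le_xhi : xlo <= xhi) (xhi_lt1 : xhi < 1)
    (rho_range : xhi * eps < rho < eps)
    (P0_10 : P0 [set (1, 0)] = rho%:E)
    (P0_00 : P0 [set (0, 0)] = (1 - rho)%:E)
    (xi_indep : mutually_independent Pr xi)
    (xi_law : forall i A, measurable A -> distribution Pr (xi i) A = P0 A)
    (theta_gt0 : forall N, 0 < theta N)
    (theta_to0 : theta N @[N --> \oo] --> 0) :
  let F N omega :=
    wasserstein_ball (ratr p) (empirical xi N omega) (theta N) in
  with_prob_to_1 Pr (fun N => [set omega | F N omega P0]) ->
  (exists2 epsbar : R, epsbar < eps &
     forall eps1 eps2 : R, 0 <= eps1 -> 0 <= eps2 -> eps1 + eps2 = eps ->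
       epsbar < eps1 < eps ->
       with_prob_to_1 Pr (fun N => [set omega |
         optimal_value (bonferroni_feasible xlo xhi eps1 eps2 (F N omega)) =
         optimal_value (joint_feasible xlo xhi eps (F N omega))])) /\
  with_prob_to_1 Pr (fun N => [set omega |
    forall w : R * R, open_simplex w ->
      cvar_feasible xlo xhi eps w (F N omega) = set0]).
Proof.
move=> F FP0.
case/andP: eps01 => eps0 eps1; case/andP: rho_range => xhi_rho rho_eps.
split; last first.
  apply: with_prob_to_1_near_sub FP0 _; apply: nearW.
  move=> N omega /= P0F w [/andP[w10 _] _ _].
  by apply: (two_point_cvar R rho P0) => //;
    [rewrite xhi_rho ltW|exact: ltW].
(* [rho] serves as the threshold: beyond it, [eps1] leaves room for the
   perturbation of the atom of mass [rho]. *)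
exists rho => // a b a0 b0 ab /andP[rho_a a_eps].
have p0 : 0 < ratr p :> R by rewrite ltr0q; exact: lt_trans p_gt1.
apply: with_prob_to_1_near_sub FP0 _; near=> N => omega /= P0F.
have Bx : bonferroni_feasible xlo xhi a b (F N omega) (xlo, 1).
  apply: (two_point_bonferroni R rho P0) => //.
  - by rewrite xlo_gt0.
  - rewrite ler_pdivrMr// mulrC -ler_pdivlMr//.
    near: N; apply: (cvgr_le _ theta_to0).
    by rewrite divr_gt0// mulr_gt0// subr_gt0.
  - rewrite mulrC -ler_pdivlMr//.
    near: N; apply: (cvgr_le _ theta_to0).
    by rewrite divr_gt0//; lra.
have Jx : joint_feasible xlo xhi eps (F N omega) (xlo, 1).
  by rewrite -ab; exact: bonferroni_sub_joint Bx.
rewrite (optimal_value_lower_bound _ xlo xhi 1)//; last by move=> ? [].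
by rewrite (optimal_value_lower_bound _ xlo xhi 1)//; move=> ? [].
Unshelve. all: by end_near.
Qed.
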